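(* The word problem for $F_1^1=G^+/\rho$ (with respect to the defining generators $G$ and relations generating $\rho$) is decidable: there is an algorithm which, given two words $u,v\in G^+$, decides whether $[u]=[v]$ in $F_1^1$.
   Context: Elements of $G$ are finite nested tuples over three symbols, so words of $G^+$ are finite data. **The set $G$.** Let $A=\{1,x,x'\}$ (three distinct symbols) with involution $'$ exchanging $x$ and $x'$ and fixing $1$. A 5-tuple is written $g=(g^{l},g^{la},g^{c},g^{ra},g^{r})$. Put $g_{xx'}=(1,1,x,x',1)$, $G_{1,e}=\{g_{xx'}\}$ and, for $i\ge 2$, $G_{i,e}=\{(g,(g^{la})',g^l,(g^{ra})',g),\ (g,(g^{ra})',g^l,(g^{la})',g) : g\in G_{i-1,e}\}$. Put $G_{1,d}=G_{2,d}=\emptyset$ and $G_i=G_{i,e}\cup G_{i,d}$, where recursively for $i\ge 3$, $G_{i,d}$ is the set of all $g\in G_{i-1}\times A\times G_{i-2}\times A\times G_{i-1}$ such that: (1) $g^l\neq g^r$; (2) $(g^c,g^{la})$ equals $((g^l)^l,((g^l)^{la})')$ or $((g^l)^r,((g^l)^{ra})')$; (3) $(g^c,g^{ra})$ equals $((g^r)^l,((g^r)^{la})')$ or $((g^r)^r,((g^r)^{ra})')$. Let $G^5=\bigcup_{i\ge1}G_i$, $G'=G^5\cup\{1\}$, $G=G^5\cup A$. The height is $\upsilon(1)=0$ and $\upsilon(g)=i$ for $g\in G_i$. **The monoid $F_1^1$.** For $g\in G^5$ with $\upsilon(g)\ge2$ let $g^L=(g^{la})'g^lg^{la}$ and $g^R=(g^{ra})'g^rg^{ra}$,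 words in the free semigroup $G^+$. Let $\rho$ be the smallest congruence on $G^+$ containing the pairs $(xx'x,x)$, $(x'xx',x')$, $(g_{xx'},xx')$; the pairs $(1g,g)$, $(g1,g)$ for $g\in G$; the pairs $(g^2,g)$ for $g\in G'$; and, for every $g\in G^5$ with $\upsilon(g)\ge 2$, the pairs $(g^cg^Lg,g)$, $(gg^Rg^c,g)$ and $(g^rg^{ra}g(g^{la})'g^l,\ g^rg^{ra}g^c(g^{la})'g^l)$. Write $[u]$ for the $\rho$-class of $u$, and $F_1^1=G^+/\rho$. *)

(* Defs.v *)
From mathcomp Require Import all_boot.

Set Implicit Arguments.
Unset Strict Implicit.
Unset Printing Implicit Defensive.

Inductive sym := s1 | sx | sx'.

Definition inv (a : sym) : sym :=
  match a with s1 => s1 | sx => sx' | sx' => sx end.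

(** [Tup gl gla gc gra gr] is the tuple (g^l, g^la, g^c, g^ra, g^r).  Not every
    [term] is an element of G: membership is the predicate [inG] below. *)
Inductive term :=
  | Atom of sym
  | Tup of term & sym & term & sym & term.

Definition one := Atom s1.
Definition X := Atom sx.
Definition X' := Atom sx'.

(** The values of the projections on atoms are junk and play no role. *)
Definition pl (g : term) := if g is Tup gl _ _ _ _ then gl else one.
Definition pla (g : term) := if g is Tup _ gla _ _ _ then gla else s1.
Definition pc (g : term) := if g is Tup _ _ gc _ _ then gc else one.
Definition pra (g : term) := if g is Tup _ _ _ gra _ then gra else s1.
Definition pr (g : term) := if g is Tup _ _ _ _ gr then gr else one.

Definition gxx' : term := Tup one s1 X sx' one.

(** [Ge i g] : g is in G_{i,e}, with i >= 1. *)
Inductive Ge : nat -> term -> Prop :=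
  | Ge_base : Ge 1 gxx'
  | Ge_l i g : Ge i g ->
      Ge i.+1 (Tup g (inv (pla g)) (pl g) (inv (pra g)) g)
  | Ge_r i g : Ge i g ->
      Ge i.+1 (Tup g (inv (pra g)) (pl g) (inv (pla g)) g).

(** [linked h c a] : (c, a) is (h^l, (h^la)') or (h^r, (h^ra)'). *)
Definition linked (h c : term) (a : sym) : Prop :=
  (c = pl h /\ a = inv (pla h)) \/ (c = pr h /\ a = inv (pra h)).

(** [Gh i g] : g is in G_i = G_{i,e} U G_{i,d}, i.e. g is in G^5 and has
    height i.  [Gh_d] with parameter i describes G_{i+3,d}. *)
Inductive Gh : nat -> term -> Prop :=
  | Gh_e i g : Ge i g -> Gh i g
  | Gh_d i gl gla gc gra gr :
      Gh i.+2 gl -> Gh i.+1 gc -> Gh i.+2 gr ->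
      gl <> gr -> linked gl gc gla -> linked gr gc gra ->
      Gh i.+3 (Tup gl gla gc gra gr).

Definition inG5 (g : term) : Prop := exists i, Gh i g.
Definition inG' (g : term) : Prop := inG5 g \/ g = one.
Definition inG (g : term) : Prop := inG5 g \/ exists a, g = Atom a.
Definition height_ge2 (g : term) : Prop := exists2 i, 2 <= i & Gh i g.

Definition word := seq term.

Fixpoint letters_in_G (w : word) : Prop :=
  if w is g :: w' then inG g /\ letters_in_G w' else True.

Definition Gplus (w : word) : Prop := w <> [::] /\ letters_in_G w.

Definition gL (g : term) : word := [:: Atom (inv (pla g)); pl g; Atom (pla g)].
Definition gR (g : term) : word := [:: Atom (inv (pra g)); pr g; Atom (pra g)].

Inductive rel : word -> word -> Prop :=
  | rel_x : rel [:: X; X'; X] [:: X]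
  | rel_x' : rel [:: X'; X; X'] [:: X']
  | rel_gxx' : rel [:: gxx'] [:: X; X']
  | rel_1l g : inG g -> rel [:: one; g] [:: g]
  | rel_1r g : inG g -> rel [:: g; one] [:: g]
  | rel_idem g : inG' g -> rel [:: g; g] [:: g]
  | rel_L g : height_ge2 g -> rel (pc g :: gL g ++ [:: g]) [:: g]
  | rel_R g : height_ge2 g -> rel (g :: gR g ++ [:: pc g]) [:: g]
  | rel_sandwich g : height_ge2 g ->
      rel [:: pr g; Atom (pra g); g; Atom (inv (pla g)); pl g]
          [:: pr g; Atom (pra g); pc g; Atom (inv (pla g)); pl g].

(** The smallest congruence on the semigroup G^+ containing [rel]; it relates
    only elements of G^+ (lemma [rho_Gplus]).  For u and v in G^+, [u] = [v] in
    the quotient G^+/rho is [rho u v]. *)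
Inductive rho : word -> word -> Prop :=
  | rho_rel u v : rel u v -> rho u v
  | rho_refl u : Gplus u -> rho u u
  | rho_sym u v : rho u v -> rho v u
  | rho_trans u v w : rho u v -> rho v w -> rho u w
  | rho_mul u u' v v' : rho u u' -> rho v v' -> rho (u ++ v) (u' ++ v').

Lemma Ge_in i g : Ge i g ->
  inG g /\ (2 <= i -> [/\ inG (pl g), inG (pc g) & inG (pr g)]).
Proof.
elim=> [|{}i {}g Hg [inGg IH]|{}i {}g Hg [inGg IH]].
- by split=> //; left; exists 1; apply: Gh_e; apply: Ge_base.
- split; first by left; exists i.+1; apply: Gh_e; apply: Ge_l.
  move=> _; split=> //=; case: Hg IH => [_|j h Hh|j h Hh] /=.
  + by right; exists s1.
  + by case: j Hh => [|j] Hh IH; [inversion Hh | case: IH].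
  + by case: j Hh => [|j] Hh IH; [inversion Hh | case: IH].
- split; first by left; exists i.+1; apply: Gh_e; apply: Ge_r.
  move=> _; split=> //=; case: Hg IH => [_|j h Hh|j h Hh] /=.
  + by right; exists s1.
  + by case: j Hh => [|j] Hh IH; [inversion Hh | case: IH].
  + by case: j Hh => [|j] Hh IH; [inversion Hh | case: IH].
Qed.

Lemma height_ge2_in g : height_ge2 g ->
  [/\ inG g, inG (pl g), inG (pc g) & inG (pr g)].
Proof.
case=> i i2 Hg; have inGg : inG g by left; exists i.
case: Hg i2 inGg => [{}i {}g Hg i2 _ | {}i gl gla gc gra gr Hl Hc Hr _ _ _ _ ?].
  by have [? /(_ i2)[]] := Ge_in Hg.
by split=> //=; left; [exists i.+2 | exists i.+1 | exists i.+2].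
Qed.

Lemma inG_Atom a : inG (Atom a). Proof. by right; exists a. Qed.

Lemma Gplus_cat u v : Gplus u -> Gplus v -> Gplus (u ++ v).
Proof.
case=> u0 Gu [v0 Gv]; split; first by case: u u0 {Gu}.
by elim: u {u0} Gu => //= g u IH [Gg /IH].
Qed.

Lemma rel_Gplus u v : rel u v -> Gplus u /\ Gplus v.
Proof.
have A := inG_Atom.
have G1 : inG gxx' by left; exists 1; apply: Gh_e; apply: Ge_base.
have G'G g : inG' g -> inG g by case=> [?|->]; [left | apply: A].
case=> [|||g Gg|g Gg|g /G'G Gg|g /height_ge2_in[? ? ? ?]
  |g /height_ge2_in[? ? ? ?]|g /height_ge2_in[? ? ? ?]];
  by split; split=> //=; do !split=> //; apply: A.
Qed.

Lemma rho_Gplus u v : rho u v -> Gplus u /\ Gplus v.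
Proof.
elim=> [{}u {}v /rel_Gplus //|//|{}u {}v _ []//|u1 u2 u3 _ [? _] _ []//|].
by move=> u1 u2 v1 v2 _ [? ?] _ [? ?]; split; apply: Gplus_cat.
Qed.

(** Algorithms: finite systems of mutually recursive first-order definitions
    over binary trees (McCarthy's recursive programs on S-expressions with
    a single atom; Jones' language F).  Each function has a single argument,
    [Arg]; tuples of arguments are passed as trees.  The model is Turing
    complete, and the semantics below is partial: a program may diverge. *)

Inductive tree := Leaf | Node of tree & tree.

Definition hd_tree (t : tree) := if t is Node a _ then a else Leaf.
Definition tl_tree (t : tree) := if t is Node _ b then b else Leaf.

Inductive expr :=
  | Arg
  | Nil
  | Cons of expr & expr
  | Hd of expr
  | Tl of expr
  | If of expr & expr & expr
  | Call of nat & expr.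

(** The i-th expression is the body of function number i. *)
Definition program := seq expr.

(** [eval P t e r] : in the program P, with [Arg] bound to t, the expression e
    terminates with value r (call by value).  In tests, [Leaf] is false. *)
Inductive eval (P : program) : tree -> expr -> tree -> Prop :=
  | eval_arg t : eval P t Arg t
  | eval_nil t : eval P t Nil Leaf
  | eval_cons t e1 e2 r1 r2 :
      eval P t e1 r1 -> eval P t e2 r2 -> eval P t (Cons e1 e2) (Node r1 r2)
  | eval_hd t e r : eval P t e r -> eval P t (Hd e) (hd_tree r)
  | eval_tl t e r : eval P t e r -> eval P t (Tl e) (tl_tree r)
  | eval_if_true t e e1 e2 a b r :
      eval P t e (Node a b) -> eval P t e1 r -> eval P t (If e e1 e2) r
  | eval_if_false t e e1 e2 r :
      eval P t e Leaf -> eval P t e2 r -> eval P t (If e e1 e2) r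
  | eval_call t f e a r :
      eval P t e a -> eval P a (nth Nil P f) r -> eval P t (Call f e) r.

(** On input t, the main function (number 0) halts with output r. *)
Definition computes (P : program) (t r : tree) : Prop :=
  eval P t (nth Nil P 0) r.

Lemma eval_det P t e r r' : eval P t e r -> eval P t e r' -> r = r'.
Proof.
move=> H; elim: H r' => {t e r}.
- by move=> t r' H; inversion H.
- by move=> t r' H; inversion H.
- by move=> t e1 e2 r1 r2 _ IH1 _ IH2 r' H; inversion H; subst;
    congr Node; [apply: IH1 | apply: IH2].
- by move=> t e r _ IH r' H; inversion H; subst; congr hd_tree; apply: IH.
- by move=> t e r _ IH r' H; inversion H; subst; congr tl_tree; apply: IH.
- move=> t e e1 e2 a b r _ IH _ IH1 r' H; inversion H; subst.
    exact: IH1.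
  by have /IH : eval P t e Leaf by [].
- move=> t e e1 e2 r _ IH _ IH2 r' H; inversion H; subst; last exact: IH2.
  by match goal with K : eval _ _ _ (Node _ _) |- _ => have := IH _ K end.
- move=> t f e a r _ IH _ IHb r' H; inversion H; subst; apply: IHb.
  by match goal with K : eval P t e _ |- _ => rewrite (IH _ K) end.
Qed.

Definition yes : tree := Node Leaf Leaf.
Definition no : tree := Leaf.

Definition enc_sym (a : sym) : tree :=
  match a with
  | s1 => Leaf
  | sx => Node Leaf Leaf
  | sx' => Node Leaf (Node Leaf Leaf)
  end.

Fixpoint enc_term (g : term) : tree :=
  match g with
  | Atom a => Node Leaf (enc_sym a)
  | Tup gl gla gc gra gr =>
      Node (Node Leaf Leaf)
        (Node (enc_term gl) (Node (enc_sym gla) (Node (enc_term gc)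
          (Node (enc_sym gra) (enc_term gr)))))
  end.

Definition enc_word (w : word) : tree :=
  foldr (fun g t => Node (enc_term g) t) Leaf w.

Definition enc_pair (u v : word) : tree := Node (enc_word u) (enc_word v).

Lemma enc_sym_inj : injective enc_sym. Proof. by case; case. Qed.

Lemma enc_term_inj : injective enc_term.
Proof.
elim=> [a|l IHl la c IHc ra r IHr] [b|l' la' c' ra' r'] //=.
  by case=> /enc_sym_inj ->.
by case=> /IHl -> /enc_sym_inj -> /IHc -> /enc_sym_inj -> /IHr ->.
Qed.

Lemma enc_word_inj : injective enc_word.
Proof.
by elim=> [|g u IH] [|h v] //= [/enc_term_inj -> /IH ->].
Qed.

(* Main.v *)
Require Import Defs.
From HB Require Import structures.
From mathcomp Require Import all_boot.
Import Defs.

Set Implicit Arguments.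
Unset Strict Implicit.
Unset Printing Implicit Defensive.

(** Let the vertices be 1 and the elements of G^5, and let an edge labelled a
    lead from k down to h when [linked k h a]; it may be climbed with the label
    a'.  Two kinds of relations let a word be read as a walk in this graph.  The
    relations of shape g^c g^L g = g and g g^R g^c = g say that a letter g stands
    for the walk that climbs from 1 to g through g^c, g^l and goes back down
    through g^r, g^c; and that a walk k, a, h, a', k that goes down an edge and
    back up may be replaced by the vertex k.  The sandwich relation says that in
    any other valley k, a, h, b, k' the bottom h may be lifted above k and k' to
    the unique vertex n with n^r = k, n^c = h, n^l = k' and matching labels.
    Both conditions in the definition of G (distinct sides for G_{i,d},
    exchanged labels for G_{i,e}) say that the valley is not of the first kind,
    so the rules for valleys never compete.  A walk from 1 to 1 can therefore be
    turned into one without valleys, a mountain, and the word problem is solved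
    once mountains are shown to be normal forms.

    Instead of a rewriting system with its termination and confluence, walks
    act on mountains.  A mountain is kept as a stack of steps; a downward step
    is pushed, while an upward step that follows a downward one meets a valley,
    which [raise] cancels or lifts, the lifting being passed on down the stack.
    The two rules hold by definition for this action ([raise_cancel],
    [raise_peak]), so the defining relations hold as soon as reading the walk of
    one letter, then a label, then the next letter amounts to one step along an
    edge ([letter_between]).  Hence congruent words yield the same mountain
    ([rho_read]).  Conversely the walk recorded in a stack spells a word, and
    each step of the action stays within a congruence class ([raise_sound],
    [read_sound]), so a word is congruent to its own mountain.  Thus two words
    are congruent iff their mountains are equal ([rhoP]), and as all the
    functions involved are structurally recursive, they are transcribed into a
    program ([decider]) that compares the two mountains. *)

(** * Equality of letters *)

Fixpoint eq_tree (s t : tree) : bool :=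
  match s, t with
  | Leaf, Leaf => true
  | Node a b, Node c d => eq_tree a c && eq_tree b d
  | _, _ => false
  end.

Lemma eq_treeP : Equality.axiom eq_tree.
Proof.
elim=> [|a IHa b IHb] [|c d] /=; try by constructor.
by apply: (iffP andP) => [[/IHa-> /IHb->] | [/IHa ? /IHb ?]].
Qed.

HB.instance Definition _ := hasDecEq.Build tree eq_treeP.
HB.instance Definition _ :=
  hasDecEq.Build sym (inj_eqAxiom enc_sym_inj).
HB.instance Definition _ :=
  hasDecEq.Build term (inj_eqAxiom enc_term_inj).

Lemma invK : involutive inv. Proof. by case. Qed.
Lemma inv_inj : injective inv. Proof. exact: (can_inj invK). Qed.

(** * The graph of linked letters *)

(** Giving 1 the height 0 is what lets [Gh_peak] lift a valley that touches the
    ground in the same way as any other. *)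
Definition vertex (i : nat) (g : term) : Prop :=
  if i is 0 then g = one else Gh i g.

Lemma Ge_pl_pr i g : Ge i g -> pl g = pr g.
Proof. by case. Qed.

Lemma Ge_pla_pra i g : Ge i g -> pla g <> pra g.
Proof.
by elim=> //= {}i {}g _ IH /inv_inj // /esym.
Qed.

Lemma Ge_gt0 i g : Ge i g -> 0 < i.
Proof. by case. Qed.

Lemma Gh_gt0 i g : Gh i g -> 0 < i.
Proof. by case=> // {}i {}g /Ge_gt0. Qed.

Lemma Gh1 g : Gh 1 g -> g = gxx'.
Proof.
move=> H; inversion H as [i g' He|]; subst.
by inversion He as [|? ? K|? ? K] => //; have := Ge_gt0 K.
Qed.

Lemma Gh_Tup i g : Gh i g -> exists l la c ra r, g = Tup l la c ra r.
Proof.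
by case=> [{}i {}g [|? ? _|? ? _]|{}i l la c ra r *]; do 5!eexists.
Qed.

(** The last clause is common to both kinds of letters, for opposite reasons:
    the sides differ in G_{i,d}, the labels in G_{i,e}.  It says that the valley
    of bottom c between r and l is not one that cancels. *)
Lemma Gh_ge2 i g : Gh i.+2 g ->
  exists l la c ra r,
    [/\ g = Tup l la c ra r,
        [/\ Gh i.+1 l, vertex i c & Gh i.+1 r],
        linked l c la, linked r c ra & ~ (l = r /\ la = ra)].
Proof.
move=> H; inversion H as [i' g' He|i' l la c ra r Hl Hc Hr neq Ll Lr]; subst.
  have Vpl j h : Ge j.+1 h -> vertex j (pl h).
    move=> K; inversion K as [|j' h' K'|j' h' K'] => //=; subst.
      by case: j K K' => [|j] _ K'; [inversion K'|apply: Gh_e].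
    by case: j K K' => [|j] _ K'; [inversion K'|apply: Gh_e].
  inversion He as [|i' h K|i' h K]; subst; do 5!eexists; split=> //.
  - by split; [apply: Gh_e|apply: Vpl|apply: Gh_e].
  - by left.
  - by right; rewrite -(Ge_pl_pr K).
  - by case=> _ /inv_inj /(Ge_pla_pra K).
  - by split; [apply: Gh_e|apply: Vpl|apply: Gh_e].
  - by right; rewrite -(Ge_pl_pr K).
  - by left.
  - by case=> _ /inv_inj/esym/(Ge_pla_pra K).
by do 5!eexists; split=> //; case.
Qed.

Lemma vertex_linked i k h a : Gh i.+1 k -> linked k h a -> vertex i h.
Proof.
case: i => [/Gh1->|i /Gh_ge2[l [la [c [ra [r [-> [Gl _ Gr] _ _ _]]]]]]].
  by case=> [[]|[]].
by case=> [[->]|[->]].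
Qed.

(** Every valley that does not cancel can be lifted inside G.  Distinct sides
    give an element of G_{i,d}, by definition.  If both sides are k, then v is
    reached from k by two edges with distinct labels; this forces k^l = k^r,
    hence k is in some G_{i,e}, and the two labels are those of k, which is the
    definition of G_{i+1,e}. *)
Lemma Gh_peak i k p v a b :
  Gh i.+1 k -> Gh i.+1 p -> linked p v b -> linked k v (inv a) ->
  ~~ ((p == k) && (inv b == a)) -> Gh i.+2 (Tup k (inv a) v b p).
Proof.
move=> Gk Gp Lp Lk; have Vv := vertex_linked Gp Lp.
case: (eqVneq p k) => [E|neq _]; last first.
  case: i Gk Gp Vv => [/Gh1 kE /Gh1 pE|i Gk Gp Vv].
    by rewrite kE pE eqxx in neq.
  by apply: Gh_d => //; apply/nesym/eqP.
subst k => /= /eqP neq.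
have neq_side : b <> inv a by move=> E; apply: neq; rewrite E invK.
have [Ep|neq_lr] := eqVneq (pl p) (pr p); last first.
  by case: Lp Lk => [[-> bE]|[-> bE]] [[E aE]|[E aE]];
    try (by case: neq_side; rewrite bE aE); rewrite E eqxx in neq_lr.
have Kp : Ge i.+1 p.
  by inversion Gp as [|? ? ? ? ? ? _ _ _ n]; subst => //; case: n.
apply: Gh_e; case: Lp Lk => [[vE bE]|[vE bE]] [[_ aE]|[_ aE]];
  try (by case: neq_side; rewrite bE aE); rewrite vE bE aE.
- exact: Ge_r.
- by rewrite -Ep; apply: Ge_l.
Qed.

(** * The action of words on mountains *)

(** An entry (d, a, p) is a step with label a that starts at p, downwards if d
    is true; the end of a step is the start of the entry pushed after it.  The
    end of the last step is not stored, as it is known wherever a stack is used: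
    1 before and after a letter, g between [climb g] and [descend g]. *)
Definition entry : Type := bool * sym * term.
Definition stack := seq entry.

(** The step from v up to k with label a.  After a downward step from p there is
    a valley at v; when it is lifted to a peak n, the last two steps go from p
    up to n and down to k, and the first of them may create a valley at p. *)
Fixpoint raise (s : stack) (v : term) (a : sym) (k : term) : stack :=
  match s with
  | (true, b, p) :: s' =>
      if (p == k) && (inv b == a) then s'
      else (true, a, Tup k (inv a) v b p)
             :: raise s' p b (Tup k (inv a) v b p)
  | _ => (false, a, v) :: s
  end.

(** [climb g] and [descend g] follow the walks from 1 to g and from g to 1 that
    make up the walk of the letter g.  The vertex of height 1 is singled out as
    the tuple whose first component is an atom. *)
Fixpoint climb (g : term) (s : stack) : stack :=
  if g is Tup l la c _ _ then
    if l is Atom _ then raise s one s1 g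
    else raise (raise (climb c s) c (inv la) l) l la g
  else s.

Fixpoint descend (g : term) (s : stack) : stack :=
  if g is Tup l _ c ra r then
    if l is Atom _ then (true, s1, g) :: s
    else descend c [:: (true, ra, r), (true, inv ra, g) & s]
  else s.

(** In terms of walks, x = 1 g x 1 and x' = x' g 1 1 for g = g_{xx'}. *)
Definition letter (g : term) (s : stack) : stack :=
  match g with
  | Atom s1 => s
  | Atom sx => (true, sx, gxx') :: raise s one s1 gxx'
  | Atom sx' => (true, s1, gxx') :: raise s one sx' gxx'
  | Tup _ _ _ _ _ => descend g (climb g s)
  end.

Arguments climb : simpl never.
Arguments descend : simpl never.
Arguments letter : simpl never.

Definition read (w : word) (s : stack) : stack :=
  foldl (fun s g => letter g s) s w.

Lemma raise_cancel s h a k : raise ((true, a, k) :: s) h (inv a) k = s.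
Proof. by rewrite /= !eqxx. Qed.

Lemma raise_cancelV s h a k : raise ((true, inv a, k) :: s) h a k = s.
Proof. by rewrite -{2}[a]invK raise_cancel. Qed.

Lemma raise_peak s l la c ra r : ~ (l = r /\ la = ra) ->
  raise ((true, ra, r) :: s) c (inv la) l
  = (true, inv la, Tup l la c ra r) :: raise s r ra (Tup l la c ra r).
Proof.
move=> neq /=; rewrite invK ifN //; apply/andP=> -[/eqP E /eqP/inv_inj E'].
by apply: neq.
Qed.

Lemma letter_vertex i g s : vertex i g -> letter g s = descend g (climb g s).
Proof.
by case: i => [->//|i /Gh_Tup[l [la [c [ra [r ->]]]]]].
Qed.

Lemma climb_Tup i l la c ra r s : Gh i.+1 l ->
  climb (Tup l la c ra r) s
  = raise (raise (climb c s) c (inv la) l) l la (Tup l la c ra r).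
Proof. by case/Gh_Tup=> [? [? [? [? [? ->]]]]]. Qed.

Lemma descend_Tup i l la c ra r s : Gh i.+1 l ->
  descend (Tup l la c ra r) s
  = descend c [:: (true, ra, r), (true, inv ra, Tup l la c ra r) & s].
Proof. by case/Gh_Tup=> [? [? [? [? [? ->]]]]]. Qed.

Lemma climb_descend i g s : vertex i g -> climb g (descend g s) = s.
Proof.
elim/ltn_ind: i g s => -[|[|i]] IH g s; first by move->.
  by move/Gh1->.
move=> /Gh_ge2[l [la [c [ra [r [-> [Gl Vc _] _ _ neq]]]]]].
rewrite (descend_Tup _ _ _ _ _ Gl) (climb_Tup _ _ _ _ _ Gl).
rewrite (IH i _ _ _ Vc) ?leqnSn // (raise_peak _ _ neq).
by rewrite !raise_cancelV.
Qed.

(** Going down from k to 1, reading a label and climbing to the next vertex h is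
    the same as walking along the edge from k to h, and likewise upwards.  In the
    induction, the part of these walks below k^c is one between (k^c, k^l) or
    (k^c, k^r); it becomes a single edge, and what remains cancels, after lifting
    the valley at k^c back to k itself when the walk uses both sides of k. *)
Lemma letter_between i k h a : Gh i.+1 k -> linked k h a ->
  (forall s, climb h (letter (Atom a) (descend k s)) = (true, a, k) :: s)
  /\ (forall s, climb k (letter (Atom (inv a)) (descend h s))
                = raise s h (inv a) k).
Proof.
elim/ltn_ind: i k h a => -[|i] IH k h a.
  by move=> /Gh1-> [[-> ->]|[-> ->]].
move=> /Gh_ge2[l [la [c [ra [r [-> [Gl _ Gr] Ll Lr neq]]]]]].
have [Dl Ul] := IH i (leqnn _) l c la Gl Ll.
have [Dr Ur] := IH i (leqnn _) r c ra Gr Lr.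
have dE s := descend_Tup la c ra r s Gl; have cE s := climb_Tup la c ra r s Gl.
case=> -[-> ->]; rewrite /= ?invK; split=> s; rewrite ?dE ?cE.
- by rewrite Ul (raise_peak _ _ neq) raise_cancelV.
- by rewrite Dl raise_cancel.
- by rewrite Ur raise_cancel.
- by rewrite Dr (raise_peak _ _ neq) raise_cancelV.
Qed.

Lemma height_ge2_Gh g : height_ge2 g -> exists i, Gh i.+2 g.
Proof. by case=> -[|[|i]] // _ Gg; exists i. Qed.

(** Each side of a relation is a sequence of vertices separated by labels, so
    [letter_between] turns it into a walk along edges.  The two walks then differ
    by cancelled valleys or, for the sandwich relation, by one lifting. *)
Lemma rel_read u v s : Defs.rel u v -> read u s = read v s.
Proof.
case=> {u v} [||||||g /height_ge2_Gh[i Gg]|g /height_ge2_Gh[i Gg]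
  |g /height_ge2_Gh[i Gg]] //=.
  move=> g [[[/Gh_gt0//|i] Gg]|-> //].
  by rewrite !(@letter_vertex i.+1) // (@climb_descend i.+1).
all: have [l [la [c [ra [r [gE [Gl Vc Gr] Ll Lr neq]]]]]] := Gh_ge2 Gg.
all: have [Dl Ul] := letter_between Gl Ll; have [Dr Ur] := letter_between Gr Lr.
all: have Lgl : linked g l (inv la) by rewrite gE; left.
all: have Lgr : linked g r (inv ra) by rewrite gE; right.
all: have [Dgl Ugl] := letter_between Gg Lgl; have [Dgr Ugr] := letter_between Gg Lgr.
all: rewrite ?invK in Ugl Ugr.
all: have Eg t := letter_vertex t (Gg : vertex i.+2 g).
all: have El t := letter_vertex t (Gl : vertex i.+1 l).
all: have Er t := letter_vertex t (Gr : vertex i.+1 r).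
all: have Ec t := letter_vertex t Vc.
all: rewrite gE /= -gE.
- rewrite Eg El Ec Ul [in LHS]gE (climb_Tup _ _ _ _ _ Gl) -gE Dl raise_cancel.
  by rewrite Eg [in RHS]gE (climb_Tup _ _ _ _ _ Gl) -gE.
- rewrite Ec Er Eg Dgr Dr; move: (climb g s) => t.
  by rewrite gE (descend_Tup _ _ _ _ _ Gl) -gE.
- by rewrite El Er Eg Ugr Dgl El Ec Dr Ul gE (raise_peak _ _ neq).
Qed.

Lemma rho_read u v : rho u v -> forall s, read u s = read v s.
Proof.
elim=> [{}u {}v /rel_read // | // | {}u {}v _ IH s | {}u {}v w _ IH1 _ IH2 s |].
- by rewrite IH.
- by rewrite IH1.
- by move=> u1 u2 v1 v2 _ IH1 _ IH2 s; rewrite /read !foldl_cat -!/(read _ _) IH1 IH2.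
Qed.

(** * A word is congruent to its mountain *)

Fixpoint spell (s : stack) (v : term) : word :=
  if s is (_, a, p) :: s' then spell s' p ++ [:: Atom a; v] else [:: v].

(** The stacks that are walks in the graph from 1 to v.  The height index is
    needed to lift valleys inside G. *)
Inductive mountain : nat -> stack -> term -> Prop :=
  | mountain_start : mountain 0 [::] one
  | mountain_down i s v a p :
      mountain i.+1 s p -> linked p v a -> mountain i ((true, a, p) :: s) v
  | mountain_up i s v a p :
      mountain i s p -> Gh i.+1 v -> linked v p (inv a) ->
      mountain i.+1 ((false, a, p) :: s) v.

Lemma mountain_vertex i s v : mountain i s v -> vertex i v.
Proof. by elim=> // {}i {}s {}v a p _ Gp /(vertex_linked Gp). Qed.

Lemma vertex_inG i g : vertex i g -> inG g.
Proof. by case: i => [->|i Gg]; [apply: inG_Atom | left; exists i.+1]. Qed.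

Lemma letters_cat u v :
  letters_in_G (u ++ v) <-> letters_in_G u /\ letters_in_G v.
Proof. by elim: u => [|g u IH] /=; tauto. Qed.

(** One rewriting step inside a word whose contexts p and q may be empty,
    whereas [rho] lives on nonempty words. *)
Lemma rho_step p q u v w : rho u v -> letters_in_G p -> letters_in_G q ->
  rho (p ++ v ++ q) w -> rho (p ++ u ++ q) w.
Proof.
move=> uv Lp Lq; apply: rho_trans.
have {}uv : rho (u ++ q) (v ++ q).
  case: q Lq => [|g q] Lq; first by rewrite !cats0.
  by apply: rho_mul => //; apply: rho_refl.
case: p Lp => [//|g p] Lp.
by apply: rho_mul => //; apply: rho_refl.
Qed.

Lemma inG_gxx' : inG gxx'.
Proof. by left; exists 1; apply/Gh_e/Ge_base. Qed.

Ltac letters := by rewrite /=; do !split=> //;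
  first [exact: inG_Atom | exact: inG_gxx' | apply: vertex_inG; eassumption
        | left; eexists; eassumption].

Lemma rho_refl_letters u : u != [::] -> letters_in_G u -> rho u u.
Proof. by move=> /eqP u0 Lu; apply: rho_refl. Qed.

Lemma vertex_idem i g : vertex i g -> rho [:: g; g] [:: g].
Proof.
move=> Vg; apply/rho_rel/rel_idem; case: i Vg => [->|i Gg]; first by right.
by left; exists i.+1.
Qed.

Lemma mountain_letters i s v : mountain i s v -> letters_in_G (spell s v).
Proof.
elim=> [|{}i {}s {}v a p M IH L|{}i {}s {}v a p M IH Gv L] /=.
- by split=> //; apply: inG_Atom.
- apply/letters_cat; split=> //=; do !split=> //; first exact: inG_Atom.
  by apply: vertex_inG (vertex_linked (mountain_vertex M) L).
- apply/letters_cat; split=> //=; do !split=> //; first exact: inG_Atom.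
  by left; exists i.+1.
Qed.

Lemma spell_rcons s v : exists w, spell s v = w ++ [:: v].
Proof.
case: s => [|[[d a] p] s] /=; first by exists [::].
by exists (spell s p ++ [:: Atom a]); rewrite -catA.
Qed.

(** Congruences that start at the current vertex v apply to the whole walk, as
    its last letter is v. *)
Lemma rho_spell i s v u w : mountain i s v -> rho (v :: u) (v :: w) ->
  rho (spell s v ++ u) (spell s v ++ w).
Proof.
move=> M r; have := mountain_letters M; have [z ->] := spell_rcons s v.
case/letters_cat=> Lz _; rewrite -!catA.
have := @rho_step z [::] (v :: u) (v :: w) (z ++ v :: w) r Lz I.
rewrite !cats0; apply.
have [_ [_ Lw]] := rho_Gplus r.
by apply: rho_refl_letters; [case: (z) | apply/letters_cat].
Qed.

Lemma Gh_height_ge2 i g : Gh i.+2 g -> height_ge2 g.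
Proof. by exists i.+2. Qed.

Lemma Gh_ge2_vertices i g : Gh i.+2 g ->
  [/\ vertex i.+2 g, vertex i.+1 (pl g), vertex i (pc g) & vertex i.+1 (pr g)].
Proof.
move=> Gg; have [? [? [? [? [? [gE [? ? ?] _ _ _]]]]]] := Gh_ge2 Gg.
by split; [exact: Gg | rewrite gE..].
Qed.

Lemma rho_pc_l i g : Gh i.+2 g -> rho [:: pc g; g] [:: g].
Proof.
move=> Gg; have [Vg Vl Vc Vr] := Gh_ge2_vertices Gg.
have rL := rho_rel (rel_L (Gh_height_ge2 Gg)).
apply: (rho_step (p := [:: _]) (q := [::]) (rho_sym rL)); try letters.
by apply: (rho_step (p := [::]) (q := [:: _; _; _; _]) (vertex_idem Vc)); try letters.
Qed.

Lemma rho_pc_r i g : Gh i.+2 g -> rho [:: g; pc g] [:: g].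
Proof.
move=> Gg; have [Vg Vl Vc Vr] := Gh_ge2_vertices Gg.
have rR := rho_rel (rel_R (Gh_height_ge2 Gg)).
apply: (rho_step (p := [::]) (q := [:: _]) (rho_sym rR)); try letters.
by apply: (rho_step (p := [:: _; _; _; _]) (q := [::]) (vertex_idem Vc)); try letters.
Qed.

(** On the left side of k, inserting k^c after the first k makes g^c g^L g appear;
    on the right side, inserting it before the last k makes g g^R g^c appear. *)
Lemma rho_valley_cancel i k h a : Gh i.+1 k -> linked k h a ->
  rho [:: k; Atom a; h; Atom (inv a); k] [:: k].
Proof.
case: i => [/Gh1->|i Gk].
  have V : vertex 1 gxx' by apply/Gh_e/Ge_base.
  have r1 := rho_rel (rel_1r inG_gxx').
  have r11 : rho [:: gxx'; one; gxx'] [:: gxx'].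
    by apply: (rho_step (p := [::]) (q := [:: _]) r1); try letters;
      apply: vertex_idem V.
  case=> -[-> ->] /=.
    apply: (rho_step (p := [::]) (q := [:: _; _; _]) r1); try letters.
    by apply: (rho_step (p := [::]) (q := [:: _; _]) r1); try letters.
  have rX := rho_rel (rel_1r (inG_Atom sx)).
  apply: (rho_step (p := [:: _]) (q := [:: _; _]) rX); try letters.
  apply: (rho_step (p := [:: _]) (q := [:: _]) (rho_sym (rho_rel rel_gxx')));
    try letters.
  apply: (rho_step (p := [::]) (q := [:: _]) (vertex_idem V)); try letters.
  exact: vertex_idem V.
have [Vg Vl Vc Vr] := Gh_ge2_vertices Gk; have kk := vertex_idem Vg.
case=> -[-> ->]; rewrite invK.
- apply: (rho_step (p := [::]) (q := [:: _; _; _; _]) (rho_sym (rho_pc_r Gk)));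
    try letters.
  by apply: (rho_step (p := [:: k]) (q := [::])
                      (rho_rel (rel_L (Gh_height_ge2 Gk)))); try letters.
- apply: (rho_step (p := [:: _; _; _; _]) (q := [::]) (rho_sym (rho_pc_l Gk)));
    try letters.
  by apply: (rho_step (p := [::]) (q := [:: k])
                      (rho_rel (rel_R (Gh_height_ge2 Gk)))); try letters.
Qed.

Lemma rho_spell_refl i s v w : mountain i s v -> letters_in_G w ->
  rho (spell s v ++ w) (spell s v ++ w).
Proof.
move=> M Lw; apply: rho_refl_letters.
  by have [z ->] := spell_rcons s v; case: z.
by apply/letters_cat; split=> //; apply: mountain_letters M.
Qed.

(** The cancelling case is [rho_valley_cancel] and the lifting case is the
    sandwich relation for the new peak, followed by the step up to that peak. *)
Lemma raise_sound i s v a k :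
  mountain i s v -> Gh i.+1 k -> linked k v (inv a) ->
  mountain i.+1 (raise s v a k) k
  /\ rho (spell s v ++ [:: Atom a; k]) (spell (raise s v a k) k).
Proof.
elim: s i v a k => [|[[[] b] p] s IH] i v a k M Gk Lk;
  have Vk : vertex i.+1 k by [].
- split; first exact: mountain_up.
  by apply: rho_spell_refl M _; letters.
- have [Mp Lp] : mountain i.+1 s p /\ linked p v b by inversion M.
  have Gp : Gh i.+1 p := mountain_vertex Mp.
  have Vp : vertex i.+1 p := Gp.
  have Vv := mountain_vertex M.
  rewrite /= -catA; case: ifPn => [/andP[/eqP pk /eqP ba]|neq].
    subst k a; split=> //; rewrite -[X in rho _ X]cats0.
    by apply: rho_spell Mp _; apply: rho_valley_cancel Gp Lp.
  have Gn := Gh_peak Gk Gp Lp Lk neq; set n := Tup _ _ _ _ _ in Gn *.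
  have Vn : vertex i.+2 n := Gn.
  have Ln : linked n p (inv b) by right.
  have [Mn rn] := IH _ _ _ _ Mp Gn Ln; split.
    by apply: mountain_down Mn _; left; rewrite /= invK.
  apply: (rho_trans (v := spell s p ++ [:: Atom b; n] ++ [:: Atom a; k])).
    apply: rho_spell Mp _; apply: rho_sym.
    by have := rho_rel (rel_sandwich (Gh_height_ge2 Gn)); rewrite /= invK.
  rewrite catA; apply: (rho_step (p := [::]) (q := [:: _; _]) rn); try letters.
  by apply: rho_spell_refl Mn _; letters.
- split; first exact: mountain_up.
  by apply: rho_spell_refl M _; letters.
Qed.

(** Here the letter g is expanded by g^c g^L g = g, and in [descend_sound] by
    g g^R g^c = g. *)
Lemma climb_sound i g s : vertex i g -> mountain 0 s one ->
  mountain i (climb g s) g /\ rho (spell s one ++ [:: g]) (spell (climb g s) g).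
Proof.
move=> + M; elim/ltn_ind: i g => -[|[|i]] IH g Vg.
- rewrite Vg; split=> //; rewrite -[X in rho _ X]cats0; apply: rho_spell M _.
  exact: (@vertex_idem 0).
- have Gg : Gh 1 gxx' by apply/Gh_e/Ge_base.
  rewrite (Gh1 Vg); have [|M' r] := @raise_sound 0 s one s1 gxx' M Gg; first by left.
  split=> //; apply: rho_trans r; apply: rho_spell M _.
  apply: (rho_step (p := [::]) (q := [:: _]) (rho_sym (rho_rel (rel_1l (inG_Atom s1)))));
     try letters.
  by apply: rho_refl_letters; try letters.
- have [_ Vl Vc Vr] := Gh_ge2_vertices Vg.
  have [Mc rc] := IH i (leqnSn _) _ Vc.
  have [l [la [c [ra [r [gE [Gl _ _] Ll Lr neq]]]]]] := Gh_ge2 Vg.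
  rewrite gE /= in Vl Vc Vr Mc rc.
  have Lgl : linked g l (inv la) by rewrite gE; left.
  have Ll' : linked l c (inv (inv la)) by rewrite invK.
  have [Ml rl] := raise_sound Mc Gl Ll'.
  have [Mg rg] := raise_sound Ml Vg Lgl.
  have -> : climb g s = raise (raise (climb c s) c (inv la) l) l la g.
    by rewrite gE (climb_Tup _ _ _ _ _ Gl).
  split=> //; apply: rho_trans rg.
  have rL := rho_rel (rel_L (Gh_height_ge2 Vg)).
  apply: (rho_trans (v := spell s one ++ [:: c; Atom (inv la); l; Atom la; g])).
    have [lE laE cE] : [/\ pl g = l, pla g = la & pc g = c] by rewrite gE.
    rewrite /gL lE laE cE in rL.
    have V1 : vertex 0 one by [].
    apply: rho_spell M _.
    apply: (rho_step (p := [:: one]) (q := [::]) (rho_sym rL)); try letters.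
    by apply: rho_refl_letters => //; letters.
  rewrite -cat_rcons -cats1.
  apply: (rho_step (p := [::]) (q := [:: _; _; _; _]) rc); try letters.
  rewrite -[_ ++ _]/(spell (climb c s) c ++ [:: Atom (inv la); l] ++ [:: Atom la; g]).
  rewrite catA.
  apply: (rho_step (p := [::]) (q := [:: _; _]) rl); try letters.
  by apply: rho_spell_refl Ml _; letters.
Qed.

Lemma descend_sound i g s : mountain i s g ->
  mountain 0 (descend g s) one /\ rho (spell s g) (spell (descend g s) one).
Proof.
elim/ltn_ind: i g s => -[|[|i]] IH g s M; have Vg := mountain_vertex M.
- move: M; rewrite Vg /= => M; split=> //.
  by have := @rho_spell_refl _ _ _ [::] M I; rewrite cats0.
- have gE := Gh1 Vg.
  have -> : descend g s = (true, s1, g) :: s by rewrite gE.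
  split; first by apply: mountain_down M _; rewrite gE; left.
  rewrite /= -[X in rho X _]cats0; apply: rho_spell M _; apply: rho_sym.
  have r1 := rho_rel (rel_1r (vertex_inG Vg)).
  by apply: (rho_step (p := [::]) (q := [:: _]) r1); try letters.
- have [_ Vl Vc Vr] := Gh_ge2_vertices Vg.
  have [l [la [c [ra [r [gE [Gl _ Gr] Ll Lr neq]]]]]] := Gh_ge2 Vg.
  have Lgr : linked g r (inv ra) by rewrite gE; right.
  have Md := mountain_down (mountain_down M Lgr) Lr.
  have [M0 r0] := IH i (leqnSn _) _ _ Md.
  have -> : descend g s = descend c [:: (true, ra, r), (true, inv ra, g) & s].
    by rewrite gE (descend_Tup _ _ _ _ _ Gl).
  split=> //; apply: rho_trans r0.
  rewrite /= -catA -[X in rho X _]cats0; apply: rho_spell M _; apply: rho_sym.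
  have [rE raE cE] : [/\ pr g = r, pra g = ra & pc g = c] by rewrite gE.
  by have := rho_rel (rel_R (Gh_height_ge2 Vg)); rewrite /gR rE raE cE.
Qed.

Lemma letter_sound g s : inG g -> mountain 0 s one ->
  mountain 0 (letter g s) one
  /\ rho (spell s one ++ [:: g]) (spell (letter g s) one).
Proof.
have V0 : vertex 0 one by [].
have G1 : Gh 1 gxx' by apply/Gh_e/Ge_base.
have V1 : vertex 1 gxx' by [].
move=> Gg M.
(* Both x and x' are walks through g_{xx'}, up by a and down by b. *)
have via_xx' a b : linked gxx' one (inv a) -> linked gxx' one b ->
    rho [:: one; Atom a; gxx'; Atom b; one] [:: one; g] ->
    letter g s = (true, b, gxx') :: raise s one a gxx' ->
    mountain 0 (letter g s) one
    /\ rho (spell s one ++ [:: g]) (spell (letter g s) one).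
  move=> La Lb rg ->; have [Mr rr] := raise_sound M G1 La; split.
    exact: mountain_down Mr Lb.
  apply: (rho_trans (v := (spell s one ++ [:: Atom a; gxx']) ++ [:: Atom b; one])).
    by rewrite -catA; apply: rho_spell M (rho_sym rg).
  apply: (rho_step (p := [::]) (q := [:: _; _]) rr); try letters.
  by apply: rho_spell_refl Mr _; letters.
have r1 a := rho_rel (rel_1r (inG_Atom a)).
case: Gg => [[i Gg]|[[] gE]]; last 1 first.
- apply: (via_xx' sx' s1); rewrite ?gE //; [by right | by left |].
  apply: (rho_step (p := [:: _; _; _]) (q := [::]) (r1 s1)); try letters.
  apply: (rho_step (p := [:: _; _]) (q := [:: _]) (rho_rel rel_gxx')); try letters.
  apply: (rho_step (p := [:: _]) (q := [:: _]) (rho_rel rel_x')); try letters.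
  apply: (rho_step (p := [:: _]) (q := [::]) (r1 sx')); try letters.
  by apply: rho_refl_letters => //; letters.
- have Vg : vertex i g by case: i Gg => [/Gh_gt0|].
  rewrite (letter_vertex _ Vg).
  have [Mc rc] := climb_sound Vg M; have [Md rd] := descend_sound Mc.
  by split=> //; apply: rho_trans rc rd.
- rewrite gE /letter; split=> //; rewrite -[X in rho _ X]cats0.
  by apply: rho_spell M _; apply: (vertex_idem V0).
- apply: (via_xx' s1 sx); rewrite ?gE //; [by left | by right |].
  apply: (rho_step (p := [::]) (q := [:: _; _; _]) (r1 s1)); try letters.
  apply: (rho_step (p := [:: _]) (q := [:: _; _]) (rho_rel rel_gxx')); try letters.
  apply: (rho_step (p := [:: _]) (q := [:: _]) (rho_rel rel_x)); try letters.
  apply: (rho_step (p := [:: _]) (q := [::]) (r1 sx)); try letters.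
  by apply: rho_refl_letters => //; letters.
Qed.

Lemma read_sound w s : letters_in_G w -> mountain 0 s one ->
  rho (spell s one ++ w) (spell (read w s) one).
Proof.
elim: w s => [|g w IH] s; first by move=> _ M;
  by have := @rho_spell_refl _ _ _ [::] M I; rewrite cats0.
move=> [Gg Gw] M; have [Mg rg] := letter_sound Gg M.
rewrite -cat_rcons -cats1.
apply: (rho_step (p := [::]) (q := w) rg) => //.
exact: IH.
Qed.

Lemma rho_one_cons w : Gplus w -> rho (one :: w) w.
Proof.
case; case: w => [//|g w] _ [Gg Gw].
apply: (rho_step (p := [::]) (q := w) (rho_rel (rel_1l Gg))) => //=.
by apply: rho_refl.
Qed.

Lemma rhoP u v : Gplus u -> Gplus v -> rho u v <-> read u [::] = read v [::].
Proof.
move=> Gu Gv; split=> [/rho_read-> // | E].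
have nf w : Gplus w -> rho w (spell (read w [::]) one).
  move=> Gw; apply: rho_trans (rho_sym (rho_one_cons Gw)) _.
  by apply: (@read_sound w [::]) mountain_start; case: Gw.
by apply: rho_trans (nf u Gu) _; rewrite E; apply/rho_sym/nf.
Qed.

(** * The decision program *)

Definition enc_bool (d : bool) : tree := if d then yes else no.

Definition enc_stack (s : stack) : tree :=
  foldr (fun e t => let: (d, a, p) := e in
    Node (Node (enc_bool d) (Node (enc_sym a) (enc_term p))) t) Leaf s.

Lemma enc_stack_inj : injective enc_stack.
Proof.
elim=> [|[[d a] p] s IH] [|[[d' a'] p'] s'] //= [Ed /enc_sym_inj-> /enc_term_inj-> /IH->].
by case: d d' Ed => [] [].
Qed.

Fixpoint const (t : tree) : expr :=
  if t is Node a b then Cons (const a) (const b) else Nil.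

Arguments const : simpl never.

Definition get_l e := Hd (Tl e).
Definition get_la e := Hd (Tl (Tl e)).
Definition get_c e := Hd (Tl (Tl (Tl e))).
Definition get_ra e := Hd (Tl (Tl (Tl (Tl e)))).
Definition get_r e := Tl (Tl (Tl (Tl (Tl e)))).
Definition is_tup e := Hd e.

Definition call_eq e1 e2 := Call 1 (Cons e1 e2).
Definition call_inv e := Call 2 e.
Definition call_raise s v a k := Call 3 (Cons s (Cons v (Cons a k))).
Definition call_climb g s := Call 4 (Cons g s).
Definition call_descend g s := Call 5 (Cons g s).
Definition call_letter g s := Call 6 (Cons g s).
Definition call_read w s := Call 7 (Cons w s).

Definition cons_entry d a v s : expr := Cons (Cons (const (enc_bool d)) (Cons a v)) s.
Definition mk_tup l la c ra r : expr :=
  Cons (const yes) (Cons l (Cons la (Cons c (Cons ra r)))).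

Definition main_body : expr :=
  call_eq (call_read (Hd Arg) Nil) (call_read (Tl Arg) Nil).

Definition eq_body : expr :=
  If (Hd Arg)
    (If (Tl Arg)
       (If (call_eq (Hd (Hd Arg)) (Hd (Tl Arg)))
          (call_eq (Tl (Hd Arg)) (Tl (Tl Arg)))
          (const no))
       (const no))
    (If (Tl Arg) (const no) (const yes)).

Definition inv_body : expr :=
  If Arg (If (Tl Arg) (const (enc_sym sx)) (const (enc_sym sx')))
    (const (enc_sym s1)).

Definition raise_body : expr :=
  let s := Hd Arg in
  let v := Hd (Tl Arg) in
  let a := Hd (Tl (Tl Arg)) in
  let k := Tl (Tl (Tl Arg)) in
  let d := Hd (Hd s) in
  let b := Hd (Tl (Hd s)) in
  let p := Tl (Tl (Hd s)) in
  let n := mk_tup k (call_inv a) v b p in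
  If d
    (If (call_eq p k)
       (If (call_eq (call_inv b) a) (Tl s)
          (cons_entry true a n (call_raise (Tl s) p b n)))
       (cons_entry true a n (call_raise (Tl s) p b n)))
    (cons_entry false a v s).

Definition climb_body : expr :=
  let g := Hd Arg in
  let s := Tl Arg in
  If (is_tup g)
    (If (is_tup (get_l g))
       (call_raise
          (call_raise (call_climb (get_c g) s) (get_c g) (call_inv (get_la g))
             (get_l g))
          (get_l g) (get_la g) g)
       (call_raise s (const (enc_term one)) (const (enc_sym s1)) g))
    s.

Definition descend_body : expr :=
  let g := Hd Arg in
  let s := Tl Arg in
  If (is_tup g)
    (If (is_tup (get_l g))
       (call_descend (get_c g)
          (cons_entry true (get_ra g) (get_r g)
             (cons_entry true (call_inv (get_ra g)) g s)))
       (cons_entry true (const (enc_sym s1)) g s))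
    s.

Definition letter_body : expr :=
  let g := Hd Arg in
  let s := Tl Arg in
  let visit a b :=
    cons_entry true (const (enc_sym b)) (const (enc_term gxx'))
      (call_raise s (const (enc_term one)) (const (enc_sym a))
         (const (enc_term gxx'))) in
  If (is_tup g)
    (call_descend g (call_climb g s))
    (If (Tl g)
       (If (Tl (Tl g)) (visit sx' s1) (visit s1 sx))
       s).

Definition read_body : expr :=
  If (Hd Arg)
    (call_read (Tl (Hd Arg)) (call_letter (Hd (Hd Arg)) (Tl Arg)))
    (Tl Arg).

Definition decider : program :=
  [:: main_body; eq_body; inv_body; raise_body; climb_body; descend_body;
      letter_body; read_body].

Notation run t e r := (eval decider t e r).

Lemma eval_const P t r : eval P t (const r) r.
Proof. by elim: r => [|a IHa b IHb]; constructor. Qed.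

Lemma eval_if P t e c e1 e2 r : eval P t e c ->
  eval P t (if c is Node _ _ then e1 else e2) r -> eval P t (If e e1 e2) r.
Proof. by case: c => [|a b] He Hr; [apply: eval_if_false | apply: eval_if_true He Hr]. Qed.

(** Expressions without calls and tests have a value that computes, which
    reduces their evaluation to conversion. *)
Fixpoint value (t : tree) (e : expr) : tree :=
  match e with
  | Arg => t
  | Cons e1 e2 => Node (value t e1) (value t e2)
  | Hd e => hd_tree (value t e)
  | Tl e => tl_tree (value t e)
  | _ => Leaf
  end.

Fixpoint straight (e : expr) : bool :=
  match e with
  | Arg | Nil => true
  | Cons e1 e2 => straight e1 && straight e2
  | Hd e | Tl e => straight e
  | If _ _ _ | Call _ _ => false
  end.

Lemma eval_straight P t e r : straight e -> value t e = r -> eval P t e r.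
Proof.
move=> + <-; elim: e => //= [_|_|e1 IH1 e2 IH2 /andP[/IH1 ? /IH2 ?]|e IH /IH|e IH /IH];
  by constructor.
Qed.

Lemma run_eq s t : run (Node s t) eq_body (enc_bool (s == t)).
Proof.
elim: s t => [|a IHa b IHb] [|c d]; apply: eval_if; try (by apply: eval_straight);
  rewrite /=; apply: eval_if; try (by apply: eval_straight); try by apply: eval_const.
rewrite /=; apply: eval_if.
  by apply: (eval_call (a := Node a c)); [apply: eval_straight | apply: IHa].
have -> : (Node a b == Node c d) = (a == c) && (b == d) by [].
case: (a == c) => /=; last exact: eval_straight.
by apply: (eval_call (a := Node b d)); [apply: eval_straight | apply: IHb].
Qed.

Lemma run_call_eq t e1 e2 r1 r2 : run t e1 r1 -> run t e2 r2 ->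
  run t (call_eq e1 e2) (enc_bool (r1 == r2)).
Proof.
move=> H1 H2; apply: (eval_call (a := Node r1 r2)); first exact: eval_cons.
exact: run_eq.
Qed.

Lemma run_inv t e a : run t e (enc_sym a) -> run t (call_inv e) (enc_sym (inv a)).
Proof.
move=> He; apply: eval_call He _; case: a => /=; rewrite /inv_body;
  (apply: eval_if; first exact: eval_arg); try exact: eval_const;
  by apply: eval_if; [by apply: eval_straight | apply: eval_const].
Qed.

Lemma run_cons_entry t d ea ep es a p s :
  run t ea (enc_sym a) -> run t ep (enc_term p) -> run t es (enc_stack s) ->
  run t (cons_entry d ea ep es) (enc_stack ((d, a, p) :: s)).
Proof.
move=> Ha Hp Hs; rewrite /cons_entry; apply: eval_cons Hs.
by apply: eval_cons; [apply: eval_const | apply: eval_cons].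
Qed.

Lemma run_mk_tup t el ela ec era er l la c ra r :
  run t el (enc_term l) -> run t ela (enc_sym la) -> run t ec (enc_term c) ->
  run t era (enc_sym ra) -> run t er (enc_term r) ->
  run t (mk_tup el ela ec era er) (enc_term (Tup l la c ra r)).
Proof.
by move=> *; apply: eval_cons; [apply: eval_const | do !apply: eval_cons].
Qed.

Definition raise_arg s v a k :=
  Node (enc_stack s) (Node (enc_term v) (Node (enc_sym a) (enc_term k))).

Lemma run_raise s v a k :
  run (raise_arg s v a k) raise_body (enc_stack (raise s v a k)).
Proof.
elim: s v a k => [|[[[] b] p] s IH] v a k; apply: eval_if;
  try (by apply: eval_straight); rewrite /=; try by apply: run_cons_entry;
  apply: eval_straight.
(* The branch that lifts the valley occurs twice in the body. *)
have deep : run (raise_arg ((true, b, p) :: s) v a k)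
    (let s := Hd Arg in
     let v := Hd (Tl Arg) in
     let a := Hd (Tl (Tl Arg)) in
     let k := Tl (Tl (Tl Arg)) in
     let b := Hd (Tl (Hd s)) in
     let p := Tl (Tl (Hd s)) in
     let n := mk_tup k (call_inv a) v b p in
     cons_entry true a n (call_raise (Tl s) p b n))
    (enc_stack ((true, a, Tup k (inv a) v b p)
                :: raise s p b (Tup k (inv a) v b p))).
  have Hn : run (raise_arg ((true, b, p) :: s) v a k)
      (mk_tup (Tl (Tl (Tl Arg))) (call_inv (Hd (Tl (Tl Arg)))) (Hd (Tl Arg))
         (Hd (Tl (Hd (Hd Arg)))) (Tl (Tl (Hd (Hd Arg)))))
      (enc_term (Tup k (inv a) v b p)).
    by apply: run_mk_tup; try apply: run_inv; apply: eval_straight.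
  apply: run_cons_entry => //; first exact: eval_straight.
  apply: (eval_call (a := raise_arg s p b (Tup k (inv a) v b p))); last exact: IH.
  by do 3!(apply: eval_cons; first exact: eval_straight).
apply: eval_if; first by apply: run_call_eq; apply: eval_straight.
rewrite (inj_eq enc_term_inj); case: (p == k) => /=; last exact: deep.
apply: eval_if.
  by apply: run_call_eq; [apply: run_inv|]; apply: eval_straight.
rewrite (inj_eq enc_sym_inj).
by case: (inv b == a) => /=; [apply: eval_straight | exact: deep].
Qed.

Lemma run_call_raise t es ev ea ek s v a k :
  run t es (enc_stack s) -> run t ev (enc_term v) -> run t ea (enc_sym a) ->
  run t ek (enc_term k) ->
  run t (call_raise es ev ea ek) (enc_stack (raise s v a k)).
Proof.
move=> Hs Hv Ha Hk; apply: (eval_call (a := raise_arg s v a k)).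
  by do !apply: eval_cons.
exact: run_raise.
Qed.

Lemma run_climb g s :
  run (Node (enc_term g) (enc_stack s)) climb_body (enc_stack (climb g s)).
Proof.
elim: g s => [a|l _ la c IHc ra r _] s;
  (apply: eval_if; first by apply: eval_straight); rewrite /=.
  by apply: eval_straight.
apply: eval_if; first by apply: eval_straight.
case: l => [a|l' la' c' ra' r'] /=.
  by apply: run_call_raise; try apply: eval_const; apply: eval_straight.
apply: run_call_raise; try (by apply: eval_straight).
apply: run_call_raise; try apply: run_inv; try (by apply: eval_straight).
by apply: (eval_call (a := Node (enc_term c) (enc_stack s)));
  [apply: eval_straight | apply: IHc].
Qed.

Lemma run_descend g s :
  run (Node (enc_term g) (enc_stack s)) descend_body (enc_stack (descend g s)).
Proof.
elim: g s => [a|l _ la c IHc ra r _] s;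
  (apply: eval_if; first by apply: eval_straight); rewrite /=.
  by apply: eval_straight.
apply: eval_if; first by apply: eval_straight.
case: l => [a|l' la' c' ra' r'] /=.
  by apply: (@run_cons_entry _ true _ _ _ s1 (Tup (Atom a) la c ra r) s);
    apply: eval_straight.
set g := Tup _ _ _ _ _.
apply: (eval_call
  (a := Node (enc_term c) (enc_stack [:: (true, ra, r), (true, inv ra, g) & s])));
  last exact: IHc.
apply: eval_cons; first by apply: eval_straight.
by do 2!(apply: run_cons_entry; try apply: run_inv; try by apply: eval_straight).
Qed.

Lemma run_letter g s :
  run (Node (enc_term g) (enc_stack s)) letter_body (enc_stack (letter g s)).
Proof.
have visit a b :
    run (Node (enc_term g) (enc_stack s))
      (cons_entry true (const (enc_sym b)) (const (enc_term gxx'))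
      (call_raise (Tl Arg) (const (enc_term one)) (const (enc_sym a))
         (const (enc_term gxx'))))
      (enc_stack ((true, b, gxx') :: raise s one a gxx')).
  apply: run_cons_entry; try apply: eval_const.
  by apply: run_call_raise; try apply: eval_const; apply: eval_straight.
apply: eval_if; first by apply: eval_straight.
case: g visit => [a|l la c ra r] visit; rewrite /=.
  apply: eval_if; first by apply: eval_straight.
  case: a visit => visit; rewrite /=; first by apply: eval_straight.
  - by apply: eval_if; [by apply: eval_straight | exact: (visit s1 sx)].
  - by apply: eval_if; [by apply: eval_straight | exact: (visit sx' s1)].
set g := Tup _ _ _ _ _.
apply: (eval_call (a := Node (enc_term g) (enc_stack (climb g s))));
  last exact: run_descend.
apply: eval_cons; first by apply: eval_straight.
by apply: (eval_call (a := Node (enc_term g) (enc_stack s)));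
  [apply: eval_straight | apply: run_climb].
Qed.

Lemma run_read w s :
  run (Node (enc_word w) (enc_stack s)) read_body (enc_stack (read w s)).
Proof.
elim: w s => [|g w IH] s; (apply: eval_if; first by apply: eval_straight);
  rewrite /=; first by apply: eval_straight.
apply: (eval_call (a := Node (enc_word w) (enc_stack (letter g s)))); last exact: IH.
apply: eval_cons; first by apply: eval_straight.
by apply: (eval_call (a := Node (enc_term g) (enc_stack s)));
  [apply: eval_straight | apply: run_letter].
Qed.

Lemma decider_computes u v :
  computes decider (enc_pair u v) (enc_bool (read u [::] == read v [::])).
Proof.
rewrite -(inj_eq enc_stack_inj); apply: run_call_eq.
- by apply: (eval_call (a := Node (enc_word u) (enc_stack [::])));
    [apply: eval_straight | apply: run_read].
- by apply: (eval_call (a := Node (enc_word v) (enc_stack [::])));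
    [apply: eval_straight | apply: run_read].
Qed.

Theorem corollary3p11 :
  exists P : program, forall u v : word, Gplus u -> Gplus v ->
    (rho u v /\ computes P (enc_pair u v) yes) \/
    (~ rho u v /\ computes P (enc_pair u v) no).
Proof.
exists decider => u v Gu Gv; have := decider_computes u v.
have [E|neq] := eqVneq (read u [::]) (read v [::]); [left|right]; split=> //.
- by apply/(rhoP Gu Gv).
- by move/(rhoP Gu Gv)/eqP; apply/negP.
Qed.
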